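(* Let $X\in\mathbb{R}^{d\times n}$, $\rho>0$, $\beta_0>0$, $\gamma>1$ and $\beta_k=\gamma^k\beta_0$. Let $F(Z)=\log\det(I+Z^TZ)$ for $Z\in\mathbb{R}^{n\times n}$ and $$L(Z,W,Y,\beta)=F(Z)+\rho\|X-XW\|_F^2+\frac{\beta}{2}\|Z-W\|_F^2+\mathrm{Tr}(Y^T(Z-W)).$$ Let $Z_0\in\mathbb{R}^{n\times n}$, $Y_0=0$, and for $k\ge 0$ define $W_{k+1}=(\beta_k I+2\rho X^TX)^{-1}(2\rho X^TX+Y_k+\beta_k Z_k)$, let $Z_{k+1}$ be a global minimizer of $Z\mapsto L(Z,W_{k+1},Y_k,\beta_k)$, and set $Y_{k+1}=Y_k+\beta_k(Z_{k+1}-W_{k+1})$. Assume moreover that $\beta_{k-1}(Z_k-Z_{k-1})\to 0$ as $k\to\infty$. Then the sequence $\{(Y_k,W_k,Z_k)\}$ has at least one accumulation point $(Y^*,W^*,Z^* )$, and every such accumulation point satisfies the KKT conditions $$Z^*=W^*,\qquad \nabla F(Z^* )+Y^*=0,\qquad 2\rho X^TX(W^*-I)=Y^*,$$ i.e. $(W^*,Z^* )$ is a stationary point of the problem $\min_{Z,W}\ \log\det(I+Z^TZ)+\rho\|X-XW\|_F^2$ subject to $Z=W$.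
   Context: $I$ is the $n\times n$ identity matrix, $\|\cdot\|_F$ the Frobenius norm, $\mathrm{Tr}$ the trace. $\nabla F(Z)=2Z(I+Z^TZ)^{-1}$ is the gradient of $F$; equivalently $U\,\mathrm{diag}\big(\tfrac{2\sigma_i}{1+\sigma_i^2}\big)V^T$ for an SVD $Z=U\,\mathrm{diag}(\sigma_i)V^T$. *)

(* Defs.v *)
From HB Require Import structures.
From Stdlib Require Import Reals ClassicalEpsilon FunctionalExtensionality.
From mathcomp Require Import all_boot all_order all_algebra.

Set Implicit Arguments.
Unset Strict Implicit.
Unset Printing Implicit Defensive.

Definition Req_bool (x y : R) : bool := if Req_EM_T x y then true else false.

Lemma Req_boolP : Equality.axiom Req_bool.
Proof.
move=> x y; rewrite /Req_bool; case: (Req_EM_T x y) => h.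
  by constructor.
by constructor.
Qed.

HB.instance Definition _ := hasDecEq.Build R Req_boolP.

Definition R_find (P : pred R) (n : nat) : option R :=
  match excluded_middle_informative (exists x, P x) with
  | left h => Some (proj1_sig (constructive_indefinite_description _ h))
  | right _ => None
  end.

Lemma R_find_correct P n x : R_find P n = Some x -> P x.
Proof.
rewrite /R_find; case: excluded_middle_informative => // h [<-].
exact: (proj2_sig (constructive_indefinite_description _ h)).
Qed.

Lemma R_find_complete (P : pred R) : (exists x, P x) -> exists n, R_find P n.
Proof.
move=> h; exists 0%N; rewrite /R_find.
by case: excluded_middle_informative.
Qed.

Lemma R_find_ext (P Q : pred R) : P =1 Q -> R_find P =1 R_find Q.
Proof.
by move=> hPQ; have -> : P = Q by apply: functional_extensionality.
Qed.

HB.instance Definition _ :=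
  hasChoice.Build R R_find_correct R_find_complete R_find_ext.

Lemma R_addNr : left_inverse R0 Ropp Rplus.
Proof. move=> x; exact: Rplus_opp_l. Qed.
Lemma R_add0r : left_id R0 Rplus.
Proof. move=> x; exact: Rplus_0_l. Qed.
Lemma R_addrA : associative Rplus.
Proof. move=> x y z; by rewrite Rplus_assoc. Qed.
Lemma R_addrC : commutative Rplus.
Proof. move=> x y; exact: Rplus_comm. Qed.

HB.instance Definition _ :=
  GRing.isZmodule.Build R R_addrA R_addrC R_add0r R_addNr.

Lemma R_mulrA : associative Rmult.
Proof. move=> x y z; by rewrite Rmult_assoc. Qed.
Lemma R_mulrC : commutative Rmult.
Proof. move=> x y; exact: Rmult_comm. Qed.
Lemma R_mul1r : left_id R1 Rmult.
Proof. move=> x; exact: Rmult_1_l. Qed.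
Lemma R_mulrDl : left_distributive Rmult Rplus.
Proof. move=> x y z; exact: Rmult_plus_distr_r. Qed.
Lemma R_oner_neq0 : (R1 : R) != (R0 : R).
Proof. by apply/Req_boolP; exact: R1_neq_R0. Qed.

HB.instance Definition _ :=
  GRing.Zmodule_isComNzRing.Build R R_mulrA R_mulrC R_mul1r R_mulrDl R_oner_neq0.

Lemma R_mulVf (x : R) : x != (R0 : R) -> Rmult (Rinv x) x = R1.
Proof. by move=> /Req_boolP hx; exact: Rinv_l. Qed.
Lemma R_invr0 : Rinv R0 = R0.
Proof. exact: Rinv_0. Qed.

HB.instance Definition _ := GRing.ComNzRing_isField.Build R R_mulVf R_invr0.

Local Open Scope ring_scope.

Definition frob2 {m n : nat} (A : 'M[R]_(m, n)) : R :=
  \sum_(i < m) \sum_(j < n) A i j ^+ 2.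

Definition Fld {n : nat} (Z : 'M[R]_n) : R :=
  ln (\det (1%:M + Z^T *m Z)).

Definition gradF {n : nat} (Z : 'M[R]_n) : 'M[R]_n :=
  (2 : R) *: (Z *m invmx (1%:M + Z^T *m Z)).

Definition Lag {d n : nat} (X : 'M[R]_(d, n)) (rho : R)
    (Z W Y : 'M[R]_n) (beta : R) : R :=
  Fld Z + rho * frob2 (X - X *m W) + beta / 2 * frob2 (Z - W)
  + \tr (Y^T *m (Z - W)).

Definition betak (gamma beta0 : R) (k : nat) : R := gamma ^+ k * beta0.

(* a sequence of matrices converges to 0 (entrywise, equivalently in any norm) *)
Definition mx_seq_to0 {m n : nat} (A : nat -> 'M[R]_(m, n)) : Prop :=
  forall eps : R, Rlt R0 eps ->
    exists N : nat, forall k : nat, (N <= k)%N ->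
      forall i j, Rlt (Rabs (A k i j)) eps.

Definition is_acc_point3 {n : nat} (Y W Z : nat -> 'M[R]_n)
    (Ys Ws Zs : 'M[R]_n) : Prop :=
  forall eps : R, Rlt R0 eps -> forall N : nat,
    exists k : nat, (N <= k)%N /\
      forall i j, Rlt (Rabs (Y k i j - Ys i j)) eps /\
                  Rlt (Rabs (W k i j - Ws i j)) eps /\
                  Rlt (Rabs (Z k i j - Zs i j)) eps.

(* Main.v *)
Require Import Defs.
From Stdlib Require Import Reals Lra.
From mathcomp Require Import all_boot all_order all_algebra perm.

(** Differentiating the Lagrangian along lines (Jacobi's formula for [det])
    shows that the minimality of [Z k.+1] means [Y k.+1 = - gradF (Z k.+1)].
    Since [betak k *: (Z k.+1 - Z k)] tends to 0 and [betak] grows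
    geometrically, the increments of [Z] are dominated by a geometric sequence,
    so [Z] converges.  By continuity of [gradF], [Y] converges too, and so does
    [W k.+1 = Z k.+1 - (betak k)^-1 *: (Y k.+1 - Y k)], to the limit of [Z].
    The whole sequence thus has a unique accumulation point, and the equation
    for [W] follows by passing to the limit in
    [2 rho X^T X (W k.+1 - 1) = Y k.+1 - betak k *: (Z k.+1 - Z k)]. *)

Import GRing.Theory.

Local Open Scope ring_scope.

(** Rewriting with these conversions exposes the Stdlib operations behind the ring structure on [R],
    the form in which [lra], [nra] and [field] recognise them. *)
Lemma R_ringE :
  ((forall x y : R, (x + y)%R = Rplus x y)
   * (forall x y : R, (x * y)%R = Rmult x y)
   * (forall x : R, (- x)%R = Ropp x) * (forall x : R, (x^-1)%R = Rinv x)
   * ((0%R : R) = R0) * ((1%R : R) = R1))%type.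
Proof. by []. Qed.

(* The factor [2] in [gradF] is parsed in [R_scope], as [IZR 2]. *)
Lemma IZR2E : IZR 2 = 2%:R.
Proof. by rewrite mulr2n. Qed.

(** * Derivatives of finite sums, products and determinants *)

Lemma derivable_pt_lim_sum (I : Type) (r : seq I) (P : pred I)
    (f : I -> R -> R) (f' : I -> R) (t : R) :
  (forall i, derivable_pt_lim (f i) t (f' i)) ->
  derivable_pt_lim (fun s => \sum_(i <- r | P i) f i s) t
    (\sum_(i <- r | P i) f' i).
Proof.
move=> df; elim: r => [|i r IH].
  rewrite big_nil; apply: (derivable_pt_lim_ext (fun=> R0)).
    by move=> s; rewrite big_nil.
  exact: derivable_pt_lim_const.
rewrite big_cons; case: ifP => Pi.
  apply: (derivable_pt_lim_ext (fun s => f i s + \sum_(j <- r | P j) f j s)).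
    by move=> s; rewrite big_cons Pi.
  exact: derivable_pt_lim_plus.
by apply: (derivable_pt_lim_ext _ _ _ _ _ IH) => s; rewrite big_cons Pi.
Qed.

(** Induction on [r] with the two-factor product rule. Since [r] has no repetition, the condition
    [j != i] removes exactly one factor. *)
Lemma derivable_pt_lim_prod (I : eqType) (r : seq I)
    (f : I -> R -> R) (f' : I -> R) (t : R) :
  uniq r -> (forall i, derivable_pt_lim (f i) t (f' i)) ->
  derivable_pt_lim (fun s => \prod_(i <- r) f i s) t
    (\sum_(i <- r) f' i * \prod_(j <- r | j != i) f j t).
Proof.
move=> + df; elim: r => [_|a r IH] /=.
  rewrite big_nil; apply: (derivable_pt_lim_ext (fun=> R1)).
    by move=> s; rewrite big_nil.
  exact: derivable_pt_lim_const.
case/andP=> aNr /IH{}IH.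
apply: (derivable_pt_lim_ext (fun s => f a s * \prod_(j <- r) f j s)).
  by move=> s; rewrite big_cons.
rewrite big_cons big_cons eqxx /=.
have -> : \prod_(j <- r | j != a) f j t = \prod_(j <- r) f j t.
  rewrite big_seq_cond [RHS]big_seq; apply: eq_bigl => j.
  by case jr: (j \in r) => //=; apply: contraNneq aNr => <-.
have -> : \sum_(i <- r) f' i * \prod_(j <- a :: r | j != i) f j t
        = f a t * \sum_(i <- r) f' i * \prod_(j <- r | j != i) f j t.
  rewrite big_distrr /= big_seq [RHS]big_seq; apply: eq_bigr => i ir.
  rewrite big_cons ifT; last by apply: contraNneq aNr => ->.
  by rewrite mulrCA.
exact: derivable_pt_lim_mult.
Qed.

Definition mx_derivable_pt_lim {m n : nat} (M : R -> 'M[R]_(m, n)) (t : R)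
    (M' : 'M[R]_(m, n)) : Prop :=
  forall i j, derivable_pt_lim (fun s => M s i j) t (M' i j).

Lemma mx_derivable_pt_lim_mul (m n p : nat) (A : R -> 'M[R]_(m, n))
    (B : R -> 'M[R]_(n, p)) (t : R) A' B' :
  mx_derivable_pt_lim A t A' -> mx_derivable_pt_lim B t B' ->
  mx_derivable_pt_lim (fun s => A s *m B s) t (A' *m B t + A t *m B').
Proof.
move=> dA dB i j; rewrite !mxE -big_split /=.
apply: (derivable_pt_lim_ext (fun s => \sum_k A s i k * B s k j)).
  by move=> s; rewrite mxE.
by apply: derivable_pt_lim_sum => k; apply: derivable_pt_lim_mult.
Qed.

(* Jacobi's formula.  The product rule turns the derivative of the Leibniz sum
   into the sum over [i] of the determinants of [M t] with its [i]-th row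
   replaced by that of [M']; these are expanded along that row. *)
Lemma derivable_pt_lim_det (n : nat) (M : R -> 'M[R]_n) (t : R) M' :
  mx_derivable_pt_lim M t M' ->
  derivable_pt_lim (fun s => \det (M s)) t (\tr (\adj (M t) *m M')).
Proof.
move=> dM.
pose N i : 'M[R]_n := \matrix_(k, j) if k == i then M' k j else M t k j.
have detN i : \det (N i) = \sum_j M' i j * cofactor (M t) i j.
  rewrite (expand_det_row _ i); apply: eq_bigr => j _.
  rewrite mxE eqxx; congr (_ * (_ * \det _)).
  (* The minors along row [i] delete the only row in which [N i] and [M t] differ. *)
  by apply/matrixP=> k l; rewrite !mxE eq_sym (negPf (neq_lift _ _)).
have -> : \tr (\adj (M t) *m M') =
    \sum_(s : 'S_n) (-1) ^+ s *
      \sum_i M' i (s i) * \prod_(j | j != i) M t j (s j).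
  transitivity (\sum_i \det (N i)).
    rewrite mxtrace_mulC /mxtrace; apply: eq_bigr => i _.
    by rewrite detN mxE; apply: eq_bigr => j _; rewrite mxE.
  rewrite /determinant exchange_big /=; apply: eq_bigr => s _.
  rewrite big_distrr /=; apply: eq_bigr => i _; congr (_ * _).
  rewrite (bigD1 i) //= mxE eqxx; congr (_ * _).
  by apply: eq_bigr => j /negPf ji; rewrite mxE ji.
apply: derivable_pt_lim_sum => s.
apply: (derivable_pt_lim_scal _ ((-1) ^+ s)).
apply: derivable_pt_lim_prod => [|i]; first exact: index_enum_uniq.
exact: dM.
Qed.

(** * The squared Frobenius norm and invertibility of shifted Gram matrices *)

Lemma sum_sqr_ge0 (I : Type) (r : seq I) (f : I -> R) :
  Rle 0 (\sum_(i <- r) f i ^+ 2).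
Proof.
elim: r => [|i r IH]; first by rewrite big_nil; apply: Rle_refl.
rewrite big_cons expr2; apply: Rplus_le_le_0_compat IH; exact: Rle_0_sqr.
Qed.

Lemma sum_sqr_eq0 (I : finType) (f : I -> R) :
  \sum_i f i ^+ 2 = 0 -> forall i, f i = 0.
Proof.
move=> + i; rewrite (bigD1 i) //= -big_filter => f0.
have := sum_sqr_ge0 _ [seq j <- index_enum I | j != i] f.
move: (\sum_(j <- _) _) f0 => x; rewrite expr2 !R_ringE => f0 x_ge0.
by apply: Rsqr_0_uniq; have := Rle_0_sqr (f i); rewrite /Rsqr; lra.
Qed.

Lemma frob2_trace (m n : nat) (A : 'M[R]_(m, n)) : frob2 A = \tr (A^T *m A).
Proof.
rewrite /frob2 exchange_big; apply: eq_bigr => j _; rewrite mxE.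
by apply: eq_bigr => i _; rewrite mxE expr2.
Qed.

Lemma frob2_ge0 (m n : nat) (A : 'M[R]_(m, n)) : Rle 0 (frob2 A).
Proof. by rewrite /frob2 pair_big; apply: sum_sqr_ge0. Qed.

Lemma frob2_eq0 (m n : nat) (A : 'M[R]_(m, n)) : frob2 A = 0 -> A = 0.
Proof.
rewrite /frob2 pair_big => /sum_sqr_eq0 A0.
by apply/matrixP => i j; rewrite mxE (A0 (i, j)).
Qed.

(** If [K] is the left kernel of the matrix, multiplying by [K^T] and taking the trace gives
    [a * frob2 K + b * frob2 (S *m K^T) = 0]. Both terms are nonnegative and [a] is positive, so
    [K = 0]. This serves both [gradF] and the update of [W]. *)
Lemma shifted_gram_unit (m n : nat) (a b : R) (S : 'M[R]_(m, n)) :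
  Rlt 0 a -> Rle 0 b -> a *: 1%:M + b *: (S^T *m S) \in unitmx.
Proof.
move=> a_gt0 b_ge0; rewrite -row_free_unit -kermx_eq0.
move: (kermx _) (mulmx_ker (a *: 1%:M + b *: (S^T *m S))) => K KM0.
apply/eqP; apply: frob2_eq0; move/(congr1 (fun T => \tr (T *m K^T))): KM0.
rewrite mul0mx mxtrace0 mulmxDr -!scalemxAr mulmx1 mulmxDl -!scalemxAl.
rewrite mxtraceD !mxtraceZ [\tr (K *m _)]mxtrace_mulC -frob2_trace.
have -> : \tr (K *m (S^T *m S) *m K^T) = frob2 (S *m K^T).
  by rewrite frob2_trace trmx_mul trmxK !mulmxA.
have := frob2_ge0 _ _ K; have := frob2_ge0 _ _ (S *m K^T).
move: (frob2 K) (frob2 (S *m K^T)) => x y y_ge0 x_ge0; rewrite !R_ringE => eq0.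
by have := Rmult_le_pos _ _ b_ge0 y_ge0; nra.
Qed.

(** * Directional derivatives of [Fld] and of the Lagrangian *)

Lemma derivable_pt_lim_gram (n : nat) (Z E : 'M[R]_n) (t : R) :
  mx_derivable_pt_lim (fun s => 1%:M + (Z + s *: E)^T *m (Z + s *: E)) t
    (E^T *m (Z + t *: E) + (Z + t *: E)^T *m E).
Proof.
have dlin (a b : R) : derivable_pt_lim (fun s => a + s * b) t b.
  rewrite -[X in derivable_pt_lim _ _ X](_ : Rplus R0 (Rmult R1 b) = b);
    last by lra.
  apply: (derivable_pt_lim_plus (fun=> a) (fun s => Rmult s b)).
    exact: derivable_pt_lim_const.
  apply: (derivable_pt_lim_scal_right (fun s => s)).
  exact: derivable_pt_lim_id.
have dZ : mx_derivable_pt_lim (fun s => Z + s *: E) t E.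
  move=> i j; apply: derivable_pt_lim_ext (dlin (Z i j) (E i j)) => s.
  by rewrite !mxE.
have dZT : mx_derivable_pt_lim (fun s => (Z + s *: E)^T) t E^T.
  move=> i j; rewrite mxE; apply: derivable_pt_lim_ext (dZ j i) => s.
  by rewrite !mxE.
move=> i j.
apply: (derivable_pt_lim_ext (fun s => (1%:M : 'M[R]_n) i j
          + ((Z + s *: E)^T *m (Z + s *: E)) i j)).
  by move=> s; rewrite [RHS]mxE.
rewrite -[X in derivable_pt_lim _ _ X]Rplus_0_l.
apply: derivable_pt_lim_plus; first exact: derivable_pt_lim_const.
exact: mx_derivable_pt_lim_mul.
Qed.

Lemma gram_unit (n : nat) (Z : 'M[R]_n) : 1%:M + Z^T *m Z \in unitmx.
Proof.
by have := shifted_gram_unit _ _ 1 1 Z Rlt_0_1 Rle_0_1; rewrite !scale1r.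
Qed.

(* By continuity along the segment [t *: Z], on which the determinant never
   vanishes and which starts at [\det 1%:M = 1]. *)
Lemma det_gram_gt0 (n : nat) (Z : 'M[R]_n) : Rlt 0 (\det (1%:M + Z^T *m Z)).
Proof.
pose f t := \det (1%:M + (0 + t *: Z)^T *m (0 + t *: Z)).
have f_cont : continuity f.
  move=> t; apply: derivable_continuous_pt; eexists.
  by apply: derivable_pt_lim_det; apply: derivable_pt_lim_gram.
have f_neq0 t : f t <> R0.
  by have := gram_unit _ (0 + t *: Z); rewrite unitmxE unitfE => /eqP.
have f0 : f R0 = R1 by rewrite /f scale0r addr0 mulmx0 addr0 det1.
have f1 : f R1 = \det (1%:M + Z^T *m Z) by rewrite /f scale1r add0r.
rewrite -f1; case: (Rlt_le_dec 0 (f R1)) => // f1_le0.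
have [||t [_ ft0]] := IVT_cor f R0 R1 f_cont; [lra | rewrite f0; lra |].
by case: (f_neq0 t).
Qed.

Lemma derivable_pt_lim_Fld (n : nat) (Z E : 'M[R]_n) :
  derivable_pt_lim (fun t => Fld (Z + t *: E)) R0 (\tr ((gradF Z)^T *m E)).
Proof.
set M := 1%:M + Z^T *m Z.
have symM : M^T = M by rewrite /M linearD /= trmx1 trmx_mul trmxK.
have M_unit : M \in unitmx by apply: gram_unit.
have dM := derivable_pt_lim_det _ _ _ _ (derivable_pt_lim_gram _ Z E R0).
have dln : derivable_pt_lim ln (\det M) (\det M)^-1.
  by apply: derivable_pt_lim_ln; apply: det_gram_gt0.
rewrite /= scale0r addr0 -/M in dM.
have -> : \tr ((gradF Z)^T *m E)
        = (\det M)^-1 * \tr (\adj M *m (E^T *m Z + Z^T *m E)).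
  rewrite -mxtraceZ scalemxAl.
  have -> : (\det M)^-1 *: \adj M = invmx M by rewrite /invmx M_unit.
  rewrite mulmxDr mxtraceD [in RHS]mulmxA.
  (* Transposition and the symmetry of [M] identify the two trace terms; their sum gives the factor
     2 of [gradF]. *)
  have -> : \tr (invmx M *m E^T *m Z) = \tr (invmx M *m (Z^T *m E)).
    rewrite -mxtrace_tr !trmx_mul trmxK trmx_inv symM.
    by rewrite mulmxA mxtrace_mulC !mulmxA.
  rewrite /gradF -/M linearZ /= trmx_mul trmx_inv symM -scalemxAl mxtraceZ.
  by rewrite mulmxA IZR2E mulr_natl.
apply: (derivable_pt_lim_ext
  (fun t => ln (\det (1%:M + (Z + t *: E)^T *m (Z + t *: E))))) => //.
apply: (derivable_pt_lim_comp
  (fun t => \det (1%:M + (Z + t *: E)^T *m (Z + t *: E))) ln).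
  exact: dM.
by rewrite scale0r addr0.
Qed.

Lemma frob2_line (m n : nat) (A E : 'M[R]_(m, n)) (t : R) :
  frob2 (A + t *: E) = frob2 A + t * (2 * \tr (A^T *m E)) + t * t * frob2 E.
Proof.
rewrite !frob2_trace [_^T]linearD linearZ /= mulmxDl !mulmxDr !mxtraceD.
rewrite -!scalemxAl -!scalemxAr !mxtraceZ.
have -> : \tr (E^T *m A) = \tr (A^T *m E) by rewrite -mxtrace_tr trmx_mul trmxK.
by rewrite !addrA mulr_natl mulrnAr mulr2n !addrA !mulrA.
Qed.

Lemma derivable_pt_lim_Lag (d n : nat) (X : 'M[R]_(d, n)) (rho beta : R)
    (Z W Y E : 'M[R]_n) :
  derivable_pt_lim (fun t => Lag X rho (Z + t *: E) W Y beta) R0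
    (\tr ((gradF Z + beta *: (Z - W) + Y)^T *m E)).
Proof.
(* Apart from [Fld], the Lagrangian restricted to the line is the polynomial [c + t l + t^2 q], with
   derivative [l] at 0. *)
pose c := rho * frob2 (X - X *m W) + beta / 2 * frob2 (Z - W)
          + \tr (Y^T *m (Z - W)).
pose l := beta * \tr ((Z - W)^T *m E) + \tr (Y^T *m E).
pose q := beta / 2 * frob2 E.
have -> : \tr ((gradF Z + beta *: (Z - W) + Y)^T *m E)
        = Rplus (\tr ((gradF Z)^T *m E)) l.
  rewrite /l; move: (gradF Z) (Z - W) => G D.
  rewrite [_^T]linearD /= [(G + _)^T]linearD linearZ /= !mulmxDl !mxtraceD.
  by rewrite -scalemxAl mxtraceZ -addrA.
apply: (derivable_pt_lim_ext (fun t =>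
  Rplus (Fld (Z + t *: E))
    (Rplus c (Rplus (Rmult t l) (Rmult (Rmult t t) q))))).
  move=> t; rewrite /Lag /c /l /q.
  have -> : Z + t *: E - W = Z - W + t *: E by rewrite addrAC.
  move: (Fld _) (Z - W) => f D.
  rewrite frob2_line [_ *m (_ + _)]mulmxDr mxtraceD -scalemxAr mxtraceZ.
  move: (frob2 _) (frob2 D) (frob2 E) (\tr _) (\tr _) (\tr _).
  by move=> *; rewrite mulr2n !R_ringE; field.
apply: derivable_pt_lim_plus; first exact: derivable_pt_lim_Fld.
rewrite -[X in derivable_pt_lim _ _ X]Rplus_0_l.
apply: derivable_pt_lim_plus; first exact: derivable_pt_lim_const.
rewrite -[X in derivable_pt_lim _ _ X](_ : Rplus (Rmult R1 l)
  (Rmult (Rplus (Rmult R1 R0) (Rmult R0 R1)) q) = l); last by ring.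
have did := derivable_pt_lim_id R0.
apply: derivable_pt_lim_plus.
  exact: (derivable_pt_lim_scal_right (fun t => t)).
apply: (derivable_pt_lim_scal_right (fun t => Rmult t t)).
exact: (derivable_pt_lim_mult (fun t => t) (fun t => t)).
Qed.

(** The direction of differentiation is the gradient [G] itself: the derivative at 0 is then
    [frob2 G], and it vanishes because [t = 0] is a minimum on [(-1, 1)]. *)
Lemma Lag_stationary (d n : nat) (X : 'M[R]_(d, n)) (rho beta : R)
    (Z W Y : 'M[R]_n) :
  (forall Z' : 'M[R]_n, Rle (Lag X rho Z W Y beta) (Lag X rho Z' W Y beta)) ->
  gradF Z + beta *: (Z - W) + Y = 0.
Proof.
move=> Zmin; set G := _ + Y.
have dG := derivable_pt_lim_Lag _ _ X rho beta Z W Y G.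
apply: frob2_eq0; rewrite frob2_trace -/G.
rewrite -(derive_pt_eq_0 _ _ _ (exist _ _ dG) dG).
apply: (deriv_minimum _ (-1) 1); [lra | lra | move=> t _ _].
by rewrite scale0r addr0; apply: Zmin.
Qed.

(** * Entrywise convergence of matrices and continuity of [gradF] *)

Definition mx_cv {m n : nat} (A : nat -> 'M[R]_(m, n)) (B : 'M[R]_(m, n)) : Prop :=
  forall i j, Un_cv (fun k => A k i j) (B i j).

Lemma Un_cv_const (a : R) : Un_cv (fun=> a) a.
Proof. by move=> e e_gt0; exists 0%N => k _; rewrite R_dist_eq. Qed.

Lemma Un_cv_sum (I : Type) (r : seq I) (P : pred I) (u : I -> nat -> R) (l : I -> R) :
  (forall i, Un_cv (u i) (l i)) ->
  Un_cv (fun k => \sum_(i <- r | P i) u i k) (\sum_(i <- r | P i) l i).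
Proof.
move=> ul; elim: r => [|i r IH].
  rewrite big_nil; apply: (Un_cv_ext (fun=> R0)) (Un_cv_const _) => k.
  by rewrite big_nil.
rewrite big_cons; case: ifP => Pi.
  apply: (Un_cv_ext (fun k => u i k + \sum_(j <- r | P j) u j k)).
    by move=> k; rewrite big_cons Pi.
  exact: CV_plus.
by apply: Un_cv_ext IH => k; rewrite big_cons Pi.
Qed.

Lemma Un_cv_prod (I : Type) (r : seq I) (P : pred I) (u : I -> nat -> R) (l : I -> R) :
  (forall i, Un_cv (u i) (l i)) ->
  Un_cv (fun k => \prod_(i <- r | P i) u i k) (\prod_(i <- r | P i) l i).
Proof.
move=> ul; elim: r => [|i r IH].
  rewrite big_nil; apply: (Un_cv_ext (fun=> R1)) (Un_cv_const _) => k.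
  by rewrite big_nil.
rewrite big_cons; case: ifP => Pi.
  apply: (Un_cv_ext (fun k => u i k * \prod_(j <- r | P j) u j k)).
    by move=> k; rewrite big_cons Pi.
  exact: CV_mult.
by apply: Un_cv_ext IH => k; rewrite big_cons Pi.
Qed.

Lemma mx_cv_const (m n : nat) (A : 'M[R]_(m, n)) : mx_cv (fun=> A) A.
Proof. by move=> i j; apply: Un_cv_const. Qed.

Lemma mx_cv_add (m n : nat) (A B : nat -> 'M[R]_(m, n)) A' B' :
  mx_cv A A' -> mx_cv B B' -> mx_cv (fun k => A k + B k) (A' + B').
Proof.
move=> AA' BB' i j; rewrite mxE.
by apply: Un_cv_ext (CV_plus _ _ _ _ (AA' i j) (BB' i j)) => k; rewrite mxE.
Qed.

Lemma mx_cv_scale (m n : nat) (a : nat -> R) (A : nat -> 'M[R]_(m, n)) a' A' :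
  Un_cv a a' -> mx_cv A A' -> mx_cv (fun k => a k *: A k) (a' *: A').
Proof.
move=> aa' AA' i j; rewrite mxE.
by apply: Un_cv_ext (CV_mult _ _ _ _ aa' (AA' i j)) => k; rewrite mxE.
Qed.

Lemma mx_cv_opp (m n : nat) (A : nat -> 'M[R]_(m, n)) A' :
  mx_cv A A' -> mx_cv (fun k => - A k) (- A').
Proof.
move=> AA' i j; rewrite mxE.
by apply: Un_cv_ext (CV_opp _ _ (AA' i j)) => k; rewrite mxE.
Qed.

Lemma mx_cv_mul (m n p : nat) (A : nat -> 'M[R]_(m, n)) (B : nat -> 'M[R]_(n, p)) A' B' :
  mx_cv A A' -> mx_cv B B' -> mx_cv (fun k => A k *m B k) (A' *m B').
Proof.
move=> AA' BB' i j; rewrite mxE.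
apply: (Un_cv_ext (fun k => \sum_l A k i l * B k l j)).
  by move=> k; rewrite mxE.
by apply: Un_cv_sum => l; apply: CV_mult.
Qed.

Lemma mx_cv_trmx (m n : nat) (A : nat -> 'M[R]_(m, n)) A' :
  mx_cv A A' -> mx_cv (fun k => (A k)^T) A'^T.
Proof.
by move=> AA' i j; rewrite mxE; apply: Un_cv_ext (AA' j i) => k; rewrite mxE.
Qed.

Lemma Un_cv_det (n : nat) (A : nat -> 'M[R]_n) A' :
  mx_cv A A' -> Un_cv (fun k => \det (A k)) (\det A').
Proof.
move=> AA'; apply: Un_cv_sum => s.
apply: CV_mult; first exact: Un_cv_const.
by apply: Un_cv_prod => i; apply: AA'.
Qed.

(** By the adjugate formula, the inverse is built from determinants and the reciprocal of a nonzero
    one. [invmx] follows that formula only on invertible matrices, whence the assumption on every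
    [A k]. *)
Lemma mx_cv_invmx (n : nat) (A : nat -> 'M[R]_n) A' :
  (forall k, A k \in unitmx) -> A' \in unitmx ->
  mx_cv A A' -> mx_cv (fun k => invmx (A k)) (invmx A').
Proof.
move=> uA uA' AA'.
have detA' : \det A' <> R0 by move: uA'; rewrite unitmxE unitfE => /eqP.
have cv_inv : Un_cv (fun k => (\det (A k))^-1) (\det A')^-1.
  apply: (continuity_seq Rinv); last exact: Un_cv_det.
  apply: continuity_pt_inv detA'; apply: derivable_continuous_pt.
  exact: derivable_pt_id.
have cv_adj : mx_cv (fun k => \adj (A k)) (\adj A').
  move=> i j; rewrite mxE.
  apply: (Un_cv_ext (fun k => cofactor (A k) j i)).
    by move=> k; rewrite mxE.
  apply: CV_mult; first exact: Un_cv_const.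
  apply: Un_cv_det => k l; rewrite !mxE.
  by apply: Un_cv_ext (AA' _ _) => ?; rewrite !mxE.
have -> : invmx A' = (\det A')^-1 *: \adj A' by rewrite /invmx uA'.
move=> i j.
apply: Un_cv_ext (mx_cv_scale _ _ _ _ _ _ cv_inv cv_adj i j) => k.
by rewrite /invmx uA.
Qed.

Lemma mx_cv_gradF (n : nat) (Z : nat -> 'M[R]_n) Z' :
  mx_cv Z Z' -> mx_cv (fun k => gradF (Z k)) (gradF Z').
Proof.
move=> ZZ'; apply: mx_cv_scale; first exact: Un_cv_const.
apply: mx_cv_mul => //; apply: mx_cv_invmx => [k||]; try exact: gram_unit.
apply: mx_cv_add; first exact: mx_cv_const.
by apply: mx_cv_mul => //; apply: mx_cv_trmx.
Qed.

Lemma mx_cv_shift (m n : nat) (A : nat -> 'M[R]_(m, n)) A' :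
  mx_cv (fun k => A k.+1) A' -> mx_cv A A'.
Proof.
move=> AA' i j e /(AA' i j)[N AN]; exists N.+1 => -[|k] /leP //.
by rewrite ltnS => /leP; apply: AN.
Qed.

Lemma mx_cv_shiftS (m n : nat) (A : nat -> 'M[R]_(m, n)) A' :
  mx_cv A A' -> mx_cv (fun k => A k.+1) A'.
Proof.
move=> AA' i j e /(AA' i j)[N AN]; exists N => k /leP Nk.
by apply: AN; apply/leP; rewrite leqW.
Qed.

Lemma mx_cv_unique (m n : nat) (A : nat -> 'M[R]_(m, n)) B C :
  mx_cv A B -> mx_cv A C -> B = C.
Proof.
by move=> AB AC; apply/matrixP => i j; apply: UL_sequence (AB i j) (AC i j).
Qed.

Lemma mx_seq_to0_cv (m n : nat) (A : nat -> 'M[R]_(m, n)) :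
  mx_seq_to0 A -> mx_cv A 0.
Proof.
move=> A0 i j e /A0[N AN]; exists N => k /leP Nk; rewrite mxE /R_dist.
by rewrite Rminus_0_r; apply: AN.
Qed.

(** There are finitely many entries, so the maximum of their thresholds works for all. *)
Lemma mx_cv_uniform (m n : nat) (A : nat -> 'M[R]_(m, n)) A' (e : R) :
  mx_cv A A' -> Rlt 0 e ->
  exists N, forall k, (N <= k)%N -> forall i j, Rlt (Rabs (A k i j - A' i j)) e.
Proof.
move=> AA' e_gt0.
have {}AA' (p : 'I_m * 'I_n) : exists N, forall k, (N <= k)%N ->
    Rlt (Rabs (A k p.1 p.2 - A' p.1 p.2)) e.
  have [N AN] := AA' p.1 p.2 _ e_gt0.
  by exists N => k /leP; apply: AN.
have [N AN] := fin_all_exists AA'.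
exists (\max_p N p)%N => k Nk i j; apply: (AN (i, j)).
exact: leq_trans (leq_bigmax _) Nk.
Qed.

(** * Cluster values and geometric increments of real sequences *)

Lemma Un_cv_cluster (u : nat -> R) (l a : R) :
  Un_cv u l ->
  (forall e, Rlt 0 e -> forall N, exists k, (N <= k)%N /\ Rlt (Rabs (u k - a)) e) ->
  a = l.
Proof.
move=> ul ua; apply: cond_eq => e e_gt0.
have e2_gt0 : Rlt 0 (Rdiv e 2) by lra.
have [N uN] := ul _ e2_gt0; have [k [/leP /uN Nk ak]] := ua _ e2_gt0 N.
rewrite /R_dist in Nk; move: ak Nk.
by split_Rabs; lra.
Qed.

Lemma geometric_increments_cv (u : nat -> R) (C q : R) (N : nat) :
  Rle 0 C -> Rle 0 q -> Rlt q 1 ->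
  (forall k, (N <= k)%N -> Rle (Rabs (u k.+1 - u k)) (Rmult C (pow q k))) ->
  exists l, Un_cv u l.
Proof.
move=> C_ge0 q_ge0 q_lt1 du.
(* [D] is the sum of the geometric series [C q^k]; telescoping the increments from [m] to [m + j]
   gives the bound [D (q^m - q^(m+j))]. *)
pose D := Rdiv C (Rminus 1 q).
have DE : Rmult D (Rminus 1 q) = C by rewrite /D; field; lra.
have D_ge0 : Rle 0 D by apply: Rle_mult_inv_pos; lra.
have tail m j : (N <= m)%N ->
    Rle (Rabs (Rminus (u (m + j)%N) (u m)))
        (Rmult D (Rminus (pow q m) (pow q (m + j)%N))).
  move=> Nm; elim: j => [|j IH].
    by rewrite addn0 Rminus_diag Rabs_R0; lra.
  have := du (m + j)%N (leq_trans Nm (leq_addr _ _)).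
  rewrite -addnS.
  have -> : pow q (m + j.+1)%N = Rmult q (pow q (m + j)%N) by rewrite addnS.
  by move: IH; rewrite -DE; split_Rabs; nra.
suff : Cauchy_crit u by case/R_complete => l ul; exists l.
move=> e e_gt0.
(* Two terms beyond [K] are each within [D q^K] of [u K], so [2 D q^K < e] is the target. The added
   1 keeps the denominator positive when [D = 0]. *)
have e'_gt0 : Rlt 0 (Rdiv e (Rplus (Rmult 2 D) 1)) by apply: Rdiv_lt_0_compat; lra.
have q_abs : Rlt (Rabs q) 1 by rewrite Rabs_pos_eq.
have [M qM] := pow_lt_1_zero q q_abs _ e'_gt0.
set K := maxn N M.
have qK_ge0 : Rle 0 (pow q K) by apply: pow_le.
have near_K n : (K <= n)%N ->
    Rle (Rabs (Rminus (u n) (u K))) (Rmult D (pow q K)).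
  move=> Kn; have := tail K (n - K)%N (leq_maxl _ _); rewrite subnKC //.
  by have := pow_le q n q_ge0; nra.
have small : Rlt (Rmult (Rmult 2 D) (pow q K)) e.
  have := qM K (leP (leq_maxr _ _)); rewrite Rabs_pos_eq // => qK.
  have eE : e = Rmult (Rdiv e (Rplus (Rmult 2 D) 1)) (Rplus (Rmult 2 D) 1).
    by field; lra.
  by rewrite [X in Rlt _ X]eE; nra.
exists K => n m /leP/near_K nK /leP/near_K mK; rewrite /R_dist.
by move: nK mK; split_Rabs; lra.
Qed.

(** * Penalty parameters, convergence of the iterates and the KKT conditions *)

Lemma inv_betakE (gamma beta0 : R) (k : nat) :
  (betak gamma beta0 k)^-1 = Rmult (Rinv beta0) (pow (Rinv gamma) k).
Proof.
have expE x : x ^+ k = pow x k :> R by elim: k => //= k <-; rewrite exprS.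
by rewrite /betak expE !R_ringE Rinv_mult Rmult_comm pow_inv.
Qed.

Lemma betak_gt0 (gamma beta0 : R) (k : nat) :
  Rlt 0 gamma -> Rlt 0 beta0 -> Rlt 0 (betak gamma beta0 k).
Proof.
move=> gamma_gt0 beta0_gt0; elim: k => [|k IH].
  by rewrite /betak expr0 R_ringE Rmult_1_l.
by rewrite /betak exprS !R_ringE Rmult_assoc; apply: Rmult_lt_0_compat.
Qed.

Theorem theorem3 (d n : nat) (X : 'M[R]_(d, n)) (rho beta0 gamma : R)
    (Y W Z : nat -> 'M[R]_n) :
  Rlt R0 rho -> Rlt R0 beta0 -> Rlt R1 gamma ->
  Y 0%N = 0 ->
  (forall k : nat,
     W k.+1 = invmx (betak gamma beta0 k *: 1%:M + (2 * rho) *: (X^T *m X))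
              *m ((2 * rho) *: (X^T *m X) + Y k + betak gamma beta0 k *: Z k)) ->
  (forall k : nat, forall Z' : 'M[R]_n,
     Rle (Lag X rho (Z k.+1) (W k.+1) (Y k) (betak gamma beta0 k))
         (Lag X rho Z' (W k.+1) (Y k) (betak gamma beta0 k))) ->
  (forall k : nat,
     Y k.+1 = Y k + betak gamma beta0 k *: (Z k.+1 - W k.+1)) ->
  mx_seq_to0 (fun k => betak gamma beta0 k *: (Z k.+1 - Z k)) ->
  (exists Ys Ws Zs : 'M[R]_n, is_acc_point3 Y W Z Ys Ws Zs) /\
  (forall Ys Ws Zs : 'M[R]_n, is_acc_point3 Y W Z Ys Ws Zs ->
     [/\ Zs = Ws,
         gradF Zs + Ys = 0
       & (2 * rho) *: (X^T *m X) *m (Ws - 1%:M) = Ys]).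
Proof.
move=> rho_gt0 beta0_gt0 gamma_gt1 _ WS Zmin YS dZ0.
set b := betak gamma beta0; pose A := (2 * rho) *: (X^T *m X).
have b_gt0 k : Rlt 0 (b k) by apply: betak_gt0 => //; lra.
have b_neq0 k : b k != 0 by apply/eqP; have := b_gt0 k; rewrite !R_ringE; lra.
have q_gt0 : Rlt 0 (Rinv gamma) by apply: Rinv_0_lt_compat; lra.
have q_lt1 : Rlt (Rinv gamma) 1 by rewrite -Rinv_1; apply: Rinv_lt_contravar; lra.
have c_gt0 : Rlt 0 (Rinv beta0) by apply: Rinv_0_lt_compat.
have b_inv_cv : Un_cv (fun k => (b k)^-1) 0.
  have -> : (0 : R) = Rmult (Rinv beta0) 0 by rewrite Rmult_0_r.
  apply: (Un_cv_ext (fun k => Rmult (Rinv beta0) (pow (Rinv gamma) k))).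
    by move=> k; rewrite -inv_betakE.
  apply: CV_mult; first exact: Un_cv_const.
  move=> e e_gt0; have [|N qN] := pow_lt_1_zero (Rinv gamma) _ e e_gt0.
    by rewrite Rabs_pos_eq; lra.
  by exists N => k /qN; rewrite /R_dist Rminus_0_r.
have Y_grad k : Y k.+1 = - gradF (Z k.+1).
  have := Lag_stationary _ _ X rho (b k) (Z k.+1) (W k.+1) (Y k) (Zmin k).
  by rewrite YS -addrA [_ + Y k]addrC => /eqP; rewrite addrC addr_eq0 => /eqP.
have [Zs Z_cv] : exists Zs, mx_cv Z Zs.
  (* With tolerance 1, the entries of [Z k.+1 - Z k] are eventually smaller than [(b k)^-1], a
     geometric sequence of ratio [Rinv gamma]. *)
  have [N ZN] := dZ0 R1 Rlt_0_1.
  have entry_cv (p : 'I_n * 'I_n) : exists l, Un_cv (fun k => Z k p.1 p.2) l.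
    apply: (geometric_increments_cv _ (Rinv beta0) (Rinv gamma) N); try lra.
    move=> k /ZN/(_ p.1 p.2); rewrite !mxE -inv_betakE -/b.
    move: (Z k.+1 _ _) (Z k _ _) => x y; rewrite !R_ringE => xy_lt1.
    rewrite Rabs_mult Rabs_pos_eq in xy_lt1; last exact: Rlt_le.
    apply: (Rmult_le_reg_l (b k)) => //; rewrite Rinv_r; first exact: Rlt_le.
    by have := b_gt0 k; lra.
  have [l Zl] := fin_all_exists entry_cv.
  by exists (\matrix_(i, j) l (i, j)) => i j; rewrite mxE; apply: (Zl (i, j)).
have Y_cv : mx_cv Y (- gradF Zs).
  (* [Y_grad] speaks of positive indices only, hence the shift. *)
  apply: mx_cv_shift => i j.
  have := mx_cv_opp _ _ _ _ (mx_cv_gradF _ _ _ (mx_cv_shiftS _ _ _ _ Z_cv)).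
  by move=> /(_ i j); apply: Un_cv_ext => k; rewrite Y_grad.
have W_cv : mx_cv W Zs.
  apply: mx_cv_shift.
  have := mx_cv_scale _ _ _ _ _ _ b_inv_cv
    (mx_cv_add _ _ _ _ _ _ (mx_cv_shiftS _ _ _ _ Y_cv) (mx_cv_opp _ _ _ _ Y_cv)).
  rewrite scale0r => /mx_cv_opp.
  move/(mx_cv_add _ _ _ _ _ _ (mx_cv_shiftS _ _ _ _ Z_cv)).
  rewrite oppr0 addr0 => ZW i j; apply: Un_cv_ext (ZW i j) => k.
  by rewrite YS addrAC subrr add0r scalerA mulVf // scale1r opprB addrC subrK.
have W_kkt : A *m (Zs - 1%:M) = - gradF Zs.
  (* Clearing the inverse in the update of [W] gives [A (W k.+1 - 1) = Y k + b k (Z k - W k.+1)];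
     the update of [Y] then eliminates [W k.+1] from the right-hand side. *)
  have AW k : A *m (W k.+1 - 1%:M) = Y k.+1 - b k *: (Z k.+1 - Z k).
    have M_unit : b k *: 1%:M + A \in unitmx.
      by apply: shifted_gram_unit => //; rewrite mulr2n !R_ringE; lra.
    have := mulKVmx M_unit (A + Y k + b k *: Z k).
    rewrite -WS mulmxDl -scalemxAl mul1mx => /(canRL (addKr _)) AW.
    rewrite mulmxBr mulmx1 AW -addrA -[A + Y k + _]addrA [A + _]addrC addrK.
    by rewrite YS !scalerBr opprB -addrA [_ - _ + _]addrC subrKA addrC addrA.
  apply: (mx_cv_unique _ _ (fun k => A *m (W k.+1 - 1%:M))).
    apply: mx_cv_mul; first exact: mx_cv_const.
    by apply: mx_cv_add (mx_cv_shiftS _ _ _ _ W_cv) (mx_cv_const _ _ _).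
  have := mx_cv_add _ _ _ _ _ _ (mx_cv_shiftS _ _ _ _ Y_cv)
    (mx_cv_opp _ _ _ _ (mx_seq_to0_cv _ _ _ dZ0)).
  rewrite oppr0 addr0 => cv i j; apply: Un_cv_ext (cv i j) => k.
  by rewrite AW.
split.
  exists (- gradF Zs), Zs, Zs => e e_gt0 N.
  have [N1 YN] := mx_cv_uniform _ _ _ _ _ Y_cv e_gt0.
  have [N2 WN] := mx_cv_uniform _ _ _ _ _ W_cv e_gt0.
  have [N3 ZN] := mx_cv_uniform _ _ _ _ _ Z_cv e_gt0.
  exists (maxn N (maxn N1 (maxn N2 N3))); split; first exact: leq_maxl.
  move=> i j; split; [|split].
  - by apply: YN; rewrite !leq_max leqnn !orbT.
  - by apply: WN; rewrite !leq_max leqnn !orbT.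
  - by apply: ZN; rewrite !leq_max leqnn !orbT.
(* All three sequences converge, so an accumulation point must coincide, entry by entry, with their
   limits. *)
move=> Yt Wt Zt acc.
have -> : Yt = - gradF Zs.
  apply/matrixP => i j; apply: (Un_cv_cluster _ _ _ (Y_cv i j)) => e e_gt0 N.
  by have [k [Nk /(_ i j)[? _]]] := acc e e_gt0 N; exists k.
have -> : Wt = Zs.
  apply/matrixP => i j; apply: (Un_cv_cluster _ _ _ (W_cv i j)) => e e_gt0 N.
  by have [k [Nk /(_ i j)[_ [? _]]]] := acc e e_gt0 N; exists k.
have -> : Zt = Zs.
  apply/matrixP => i j; apply: (Un_cv_cluster _ _ _ (Z_cv i j)) => e e_gt0 N.
  by have [k [Nk /(_ i j)[_ [_ ?]]]] := acc e e_gt0 N; exists k.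
by split; rewrite ?subrr.
Qed.
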